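(* Let $m,n\in\mathbb{N}=\{1,2,\dotsc\}$. Then for all $z\in\mathbb{C}$, $$ {}_2F_1\Bigl(\frac{1-n}{2},\frac{2-n}{2};\frac{3}{2}-m;z^2\Bigr) =\frac{1}{2^{m+1}}\frac{(m-1)!}{(2m-3)!!}\sum_{k=1}^{m}2^k\binom{n-1}{k-1}\binom{2m-k-1}{m-1}\bigl[(1-z)^{n-k}-(-1)^{k}(1+z)^{n-k}\bigr]z^{k-1}, $$ where terms with $k>n$ (whose coefficient $\binom{n-1}{k-1}$ is $0$) are read as $0$ for every $z$, including $z=\pm1$.
   Context: The Gauss hypergeometric function is ${}_2F_1(a,b;c;x)=\sum_{j=0}^\infty\frac{(a)_j(b)_j}{(c)_j}\frac{x^j}{j!}$ with $c\notin\{0,-1,-2,\dotsc\}$, where $(x)_j=x(x+1)\dotsm(x+j-1)$ and $(x)_0=1$. Here one of the upper parameters is a nonpositive integer, so the series terminates and is a polynomial in $z$. Double factorials: $(2r-1)!!=1\cdot3\dotsm(2r-1)$ for $r\ge1$ and $(-1)!!=1$. Binomial coefficients with nonnegative integer entries are the usual ones, with $\binom{p}{q}=0$ for $q>p\ge0$. The convention $z^0=1$, and $w^0=1$ for all $w$, is used. *)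

(* Defs.v *)
From HB Require Import structures.
From mathcomp Require Import all_boot all_order all_algebra.
From mathcomp Require Import all_classical all_reals all_analysis.

Set Implicit Arguments.
Unset Strict Implicit.
Unset Printing Implicit Defensive.

Import Order.TTheory GRing.Theory Num.Theory.
Import numFieldNormedType.Exports.

Local Open Scope ring_scope.

Definition pochhammer (K : pzSemiRingType) (x : K) (j : nat) : K :=
  \prod_(i < j) (x + i%:R).

(* The sum of the series is the limit of its partial sums in the norm topology
   of K.  The value is meaningful when c is not a nonpositive integer and the
   series converges, in particular when it terminates. *)
Definition hyp2F1 (K : numFieldType) (a b c x : K) : K :=
  limn (series (fun j : nat =>
    pochhammer a j * pochhammer b j / pochhammer c j * (x ^+ j / j`!%:R))).

(* odd_dfact r = (2r - 1)!!, with odd_dfact 0 = (-1)!! = 1;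
   in particular odd_dfact m.-1 = (2m - 3)!! for 1 <= m. *)
Definition odd_dfact (r : nat) : nat := (\prod_(1 <= i < r.+1) (2 * i - 1))%N.

(* Main.v *)
Require Import Defs.
From HB Require Import structures.
From mathcomp Require Import all_boot all_order all_algebra.
From mathcomp Require Import complex.
From mathcomp Require Import all_classical all_reals all_analysis.
From mathcomp Require Import ring.

(* With N = n - 1 and M = m - 1, the coefficient of z^p in the sum over k is
   2 C(N,p) (1 + (-1)^p) T(M,p), where
   T(M,p) = sum_i (-2)^i C(2M-i,M) C(p,i) = [x^M] (1-2x)^p (1-x)^(-M-1).
   Since (1-2x)^2 = 1 - 4x(1-x), one has T(M+1,p+2) = T(M+1,p) - 4 T(M,p), and
   induction on j gives T(M,2j) = C(2M,M) (1/2)_j / (1/2-M)_j, which matches the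
   hypergeometric coefficient because
   (-N/2)_j ((1-N)/2)_j = C(N,2j) j! (1/2)_j. *)

Set Implicit Arguments.
Unset Strict Implicit.
Unset Printing Implicit Defensive.

Import Order.TTheory GRing.Theory Num.Theory.
Import numFieldNormedType.Exports.

Local Open Scope ring_scope.
Local Open Scope complex_scope.

Lemma pochhammerSr (K : pzSemiRingType) (x : K) (j : nat) :
  pochhammer x j.+1 = pochhammer x j * (x + j%:R).
Proof. by rewrite /pochhammer big_ord_recr. Qed.

Lemma pochhammerSl (K : pzSemiRingType) (x : K) (j : nat) :
  pochhammer x j.+1 = x * pochhammer (x + 1) j.
Proof.
rewrite /pochhammer big_ord_recl addr0; congr (_ * _).
by apply: eq_bigr => i _; rewrite /= /bump /= natrD addrA.
Qed.

(** Twice the left side is the odd integer 2a + 1 - 2b. This keeps every Pochhammer denominator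
    nonzero. *)
Lemma half_subnat_neq0 (K : numFieldType) (a b : nat) :
  1 / 2 + a%:R - b%:R != 0 :> K.
Proof.
have -> : 1 / 2 + a%:R - b%:R = ((2 * a + 1)%:R - (2 * b)%:R) / 2 :> K.
  by rewrite natrD !natrM; field.
rewrite mulf_neq0 ?invr_neq0 ?pnatr_eq0 // subr_eq0 eqr_nat.
by apply/eqP => /(congr1 odd); rewrite oddD !oddM.
Qed.

Lemma pochhammer_half_neq0 (K : numFieldType) (M j : nat) :
  pochhammer (1 / 2 - M%:R : K) j != 0.
Proof.
by apply/prodf_neq0 => i _; rewrite addrAC half_subnat_neq0.
Qed.

Lemma central_binS (M : nat) :
  (M.+1 * 'C(2 * M.+1, M.+1) = 2 * (2 * M + 1) * 'C(2 * M, M))%N.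
Proof.
have h1 := mul_bin_diag (2 * M).+2 M.
have h2 := mul_bin_diag (2 * M).+1 M.
have h3 : 'C((2 * M).+1, M.+1) = 'C((2 * M).+1, M).
  rewrite -[RHS]bin_sub; last by rewrite -ltnS mulSn mul1n -addnS leq_addr.
  by congr ('C(_, _)); rewrite mul2n -addnn -addnS addKn.
have -> : (2 * M.+1 = (2 * M).+2)%N by rewrite mulnS.
rewrite /= in h1 h2.
rewrite -h1 -h3 (_ : (2 * M).+2 = 2 * M.+1)%N; last by rewrite mulnS.
by rewrite -!mulnA -h2 addn1.
Qed.

(** Turns the prefactor (m-1)!/(2m-3)!! into 2^M / C(2M,M), which cancels the central binomial
    coefficient in T(M,2j). *)
Lemma central_bin_odd_dfact (M : nat) :
  ('C(2 * M, M) * M`! = 2 ^ M * odd_dfact M)%N.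
Proof.
elim: M => [|M IH]; first by rewrite /odd_dfact big_geq.
have hd : odd_dfact M.+1 = (odd_dfact M * (2 * M + 1))%N.
  by rewrite /odd_dfact big_nat_recr //= mulnS add2n subn1 addn1.
rewrite factS mulnCA mulnA central_binS -mulnA IH hd expnS.
by ring.
Qed.

Lemma bin_mul_bin (N p i : nat) : (i <= p)%N -> (p <= N)%N ->
  ('C(N, p) * 'C(p, i) = 'C(N, i) * 'C(N - i, p - i))%N.
Proof.
move=> ip pN; have iN := leq_trans ip pN.
have h : (0 < i`! * ((p - i)`! * (N - p)`!))%N by rewrite !muln_gt0 !fact_gt0.
apply/eqP; rewrite -(eqn_pmul2r h); apply/eqP.
have h1 := bin_fact pN; have h2 := bin_fact ip; have h3 := bin_fact iN.
have h4 := @bin_fact (N - i) (p - i) (leq_sub2r i pN).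
rewrite subnBA // subnK // in h4.
transitivity ('C(N, p) * ('C(p, i) * (i`! * (p - i)`!) * (N - p)`!))%N.
  by ring.
rewrite h2 h1 -h3 -h4; by ring.
Qed.

(** Since C(N,p) C(p,i) = C(N,i) C(N-i,p-i), the terms i <= p <= N are a binomial expansion and all
    others vanish. For i > N the truncated exponent is harmless, as C(N,i) = 0. *)
Lemma sum_bin_bin_exp (K : comNzRingType) (N L i : nat) (w : K) : (N < L)%N ->
  \sum_(p < L) ('C(N, p) * 'C(p, i))%:R * w ^+ p =
  'C(N, i)%:R * (1 + w) ^+ (N - i) * w ^+ i.
Proof.
move=> NL; case: (leqP i N) => [iN|Ni]; last first.
  rewrite bin_small // !mul0r big1 // => p _.
  case: (leqP p N) => pN; last by rewrite bin_small // mul0n mul0r.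
  by rewrite [binomial p i]bin_small ?muln0 ?mul0r // (leq_ltn_trans pN).
rewrite -(big_mkord predT (fun p => ('C(N, p) * 'C(p, i))%:R * w ^+ p)).
rewrite (big_cat_nat (n := i)) //=; last by rewrite (leq_trans iN) // ltnW.
rewrite big_nat big1 ?add0r; last first.
  by move=> p pi; rewrite [binomial p i]bin_small // muln0 mul0r.
rewrite (big_cat_nat (n := N.+1)) //=; last exact: ltnW.
rewrite [X in _ + X]big_nat [X in _ + X]big1 ?addr0; last first.
  by move=> p /andP[pN _]; rewrite bin_small // mul0n mul0r.
rewrite -{1}(add0n i) big_addn subSn // big_mkord exprDn mulr_sumr mulr_suml.
apply: eq_bigr => q _; rewrite bin_mul_bin ?leq_addl //; last first.
  by rewrite addnC -leq_subRL // -ltnS ltn_ord.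
by rewrite addnK expr1n mul1r natrM exprD mulrnAr -[in RHS]mulr_natl; ring.
Qed.

Lemma sum_even_odd (V : nmodType) (f : nat -> V) (n : nat) :
  \sum_(p < 2 * n) f p = \sum_(j < n) (f (2 * j)%N + f (2 * j).+1).
Proof.
elim: n => [|n IH]; first by rewrite !big_ord0.
by rewrite mulnS !big_ord_recr /= IH addrA.
Qed.

Lemma sum_mul_binS (K : pzSemiRingType) (a : nat -> K) (n p : nat) :
  \sum_(i < n.+1) a i * 'C(p.+1, i)%:R =
  \sum_(i < n.+1) a i * 'C(p, i)%:R + \sum_(i < n) a i.+1 * 'C(p, i)%:R.
Proof.
rewrite !big_ord_recl !bin0 -addrA; congr (_ + _); rewrite -big_split /=.
by apply: eq_bigr => i _; rewrite -mulrDr -natrD -binS.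
Qed.

(* The T(M,p) of the header. *)
Definition bin_moment (K : pzRingType) (M p : nat) : K :=
  \sum_(i < M.+1) (-2) ^+ i * 'C(2 * M - i, M)%:R * 'C(p, i)%:R.

Lemma bin_moment0 (K : pzRingType) (M : nat) :
  bin_moment K M 0 = 'C(2 * M, M)%:R.
Proof.
rewrite /bin_moment big_ord_recl big1 ?addr0 => [|i _].
  by rewrite expr0 mul1r subn0 mulr1.
by rewrite /= bin0n mulr0.
Qed.

(** In place of generating functions, Pascal's rule in p is applied twice; what remains is the
    termwise identity 2 a_(i+1) + a_(i+2) = -4 (-2)^i C(2M-i,M), again Pascal's rule. *)
Lemma bin_momentSS (K : comNzRingType) (M p : nat) :
  bin_moment K M.+1 p.+2 = bin_moment K M.+1 p - 4 * bin_moment K M p.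
Proof.
rewrite /bin_moment.
set a := fun i => (-2 : K) ^+ i * 'C(2 * M.+1 - i, M.+1)%:R.
rewrite (sum_mul_binS a) (sum_mul_binS a _ p) (sum_mul_binS (fun i => a i.+1)).
rewrite -!addrA; congr (_ + _).
(* The added term i = M contains C(M,M+1) = 0. *)
have -> : \sum_(i < M) a i.+2 * 'C(p, i)%:R =
          \sum_(i < M.+1) a i.+2 * 'C(p, i)%:R.
  rewrite big_ord_recr /= [X in _ + X](_ : _ = 0) ?addr0 //.
  rewrite /a bin_small ?mulr0 ?mul0r //.
  by rewrite mul2n -addnn addSn addnS !subSS addnK.
rewrite -!big_split mulr_sumr -sumrN /=; apply: eq_bigr => i _; rewrite /a.
have iM : (i <= 2 * M)%N by rewrite (@leq_trans M) ?leq_pmull // -ltnS ltn_ord.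
have -> : (2 * M.+1 - i.+1 = (2 * M - i).+1)%N.
  by rewrite mulnS add2n subSS subSn.
have -> : (2 * M.+1 - i.+2 = 2 * M - i)%N by rewrite mulnS add2n !subSS.
rewrite binS natrD !exprS; by ring.
Qed.

Lemma bin_moment_even (K : numFieldType) (M j : nat) :
  bin_moment K M (2 * j) = 'C(2 * M, M)%:R *
    (pochhammer (1 / 2) j / pochhammer (1 / 2 - M%:R) j).
Proof.
elim: j M => [|j IH] M.
  by rewrite bin_moment0 /pochhammer !big_ord0 divr1 mulr1.
(* The recurrence lowers M, so M = 0 is separate: the moment is 1 and the two Pochhammer symbols
   coincide. *)
case: M => [|M].
  have := pochhammer_half_neq0 K 0 j.+1; rewrite mulr0n subr0 => n0.
  by rewrite /bin_moment big_ord1 expr0 !bin0 divff ?mulr1.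
rewrite mulnS add2n bin_momentSS !IH !pochhammerSr.
(* Splitting off the last or the first factor of (1/2-M-1)_(j+1) relates the symbols at 1/2-M-1 and
   1/2-M. *)
have hS := pochhammerSl (1 / 2 - M.+1%:R : K) j.
rewrite pochhammerSr in hS.
have e1 : 1 / 2 - M.+1%:R + 1 = 1 / 2 - M%:R :> K by rewrite -natr1; ring.
rewrite e1 in hS.
have n0 := pochhammer_half_neq0 K M.+1 j.
have n2 : 1 / 2 - M.+1%:R != 0 :> K.
  by have := half_subnat_neq0 K 0 M.+1; rewrite addr0.
have n3 : 1 / 2 - M.+1%:R + j%:R != 0 :> K by rewrite addrAC half_subnat_neq0.
have hD : pochhammer (1 / 2 - M%:R) j = pochhammer (1 / 2 - M.+1%:R) j *
    (1 / 2 - M.+1%:R + j%:R) / (1 / 2 - M.+1%:R) :> K.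
  by rewrite hS [_ * pochhammer _ _]mulrC mulfK.
have hB : 'C(2 * M.+1, M.+1)%:R =
    2 * (2 * M%:R + 1) * 'C(2 * M, M)%:R / M.+1%:R :> K.
  have nM : M.+1%:R != 0 :> K by rewrite pnatr_eq0.
  have := congr1 (fun k => k%:R : K) (central_binS M).
  rewrite !natrM natrD natrM => h.
  by rewrite -h mulrAC divff // mul1r.
rewrite hD hB -natr1; field.
have n20 : 2 != 0 :> K by rewrite pnatr_eq0.
apply/and4P; split => //.
(* The remaining side condition is twice the quantity in [n3]. *)
by have := mulf_neq0 n3 n20; congr (_ != 0); rewrite -natr1; field.
Qed.

(** The new factors on the left multiply to (N-2j)(N-2j-1)/4, which is two steps of C(N,.), and
    (2j+1)(2j+2)/4 = (j+1)(j+1/2). *)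
Lemma pochhammer_dup_bin (K : numFieldType) (N j : nat) :
  pochhammer (- N%:R / 2) j * pochhammer ((1 - N%:R) / 2) j =
  'C(N, 2 * j)%:R * j`!%:R * pochhammer (1 / 2) j :> K.
Proof.
elim: j => [|j IH]; first by rewrite /pochhammer !big_ord0 bin0 !mulr1.
rewrite !pochhammerSr mulrACA IH.
(* The subtraction is taken in K; for k > N both sides vanish. *)
have h (k : nat) : k.+1%:R * 'C(N, k.+1)%:R = (N%:R - k%:R) * 'C(N, k)%:R :> K.
  rewrite -natrM mul_bin_left natrM.
  case: (leqP k N) => kN; first by rewrite natrB.
  by rewrite bin_small // !mulr0.
have h1 := h (2 * j)%N; have h2 := h (2 * j).+1.
have n1 : (2 * j).+1%:R != 0 :> K by rewrite pnatr_eq0.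
have n2 : (2 * j).+2%:R != 0 :> K by rewrite pnatr_eq0.
rewrite mulnS add2n factS natrM.
apply: (mulfI n2); rewrite !mulrA h2; apply: (mulfI n1).
transitivity (((2 * j).+1%:R * 'C(N, (2 * j).+1)%:R) * (N%:R - (2 * j).+1%:R) *
  j.+1%:R * j`!%:R * (pochhammer (1 / 2) j * (1 / 2 + j%:R)) : K); last by ring.
by rewrite h1 -!natr1 !natrM; field.
Qed.

(** The partial sums are eventually constant. Vanishing is asked of the product because the parity
    of n decides which upper parameter terminates the series. *)
Lemma hyp2F1_finite (K : numFieldType) (a b c x : K) (n : nat) :
  (forall j, (n <= j)%N -> pochhammer a j * pochhammer b j = 0) ->
  hyp2F1 a b c x = \sum_(j < n)
    pochhammer a j * pochhammer b j / pochhammer c j * (x ^+ j / j`!%:R).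
Proof.
move=> h0; apply: lim_near_cst; first exact: norm_hausdorff.
exists n => // k /= nk; rewrite /series /= (big_cat_nat (n := n)) //=.
rewrite [X in _ + X]big_nat [X in _ + X]big1 ?addr0 ?big_mkord //.
by move=> j /andP[nj _]; rewrite h0 // !mul0r.
Qed.

Lemma sum_bin_moment (K : comNzRingType) (M N : nat) (z : K) :
  \sum_(i < M.+1) 2 ^+ i * 'C(N, i)%:R * 'C(2 * M - i, M)%:R *
    ((1 - z) ^+ (N - i) + (-1) ^+ i * (1 + z) ^+ (N - i)) * z ^+ i =
  2 * \sum_(j < N.+1) 'C(N, 2 * j)%:R * bin_moment K M (2 * j) * z ^+ (2 * j).
Proof.
have NL : (N < 2 * N.+1)%N by rewrite mulnS add2n ltnS ltnW // ltnS leq_pmull.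
(* The bound exceeds N and is even, so that the terms pair up by parity; those with odd p cancel. *)
transitivity (\sum_(p < 2 * N.+1)
    'C(N, p)%:R * bin_moment K M p * ((- z) ^+ p + z ^+ p)).
  under [RHS]eq_bigr => p _ do rewrite /bin_moment mulr_sumr mulr_suml.
  rewrite exchange_big; apply: eq_bigr => i _ /=.
  transitivity ((-2) ^+ i * 'C(2 * M - i, M)%:R *
      ('C(N, i)%:R * (1 + - z) ^+ (N - i) * (- z) ^+ i +
       'C(N, i)%:R * (1 + z) ^+ (N - i) * z ^+ i)).
    have h2 : (-2) ^+ i = (-1) ^+ i * 2 ^+ i :> K by rewrite -exprMn mulN1r.
    have h1 : (-1) ^+ i * (-1) ^+ i = 1 :> K.
      by rewrite -exprMn mulrNN mulr1 expr1n.
    rewrite h2 [(- z) ^+ i]exprNn -[LHS]mul1r -{1}h1; ring: h1.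
  rewrite -!(sum_bin_bin_exp _ _ NL) -big_split mulr_sumr /=.
  by apply: eq_bigr => p _; rewrite natrM; ring.
rewrite (sum_even_odd (fun p => 'C(N, p)%:R * bin_moment K M p *
  ((- z) ^+ p + z ^+ p))) mulr_sumr; apply: eq_bigr => j _.
have he : (- z) ^+ (2 * j) = z ^+ (2 * j) by rewrite !exprM sqrrN.
rewrite !exprS he; ring.
Qed.

Theorem theorem2p1 (R : realType) (m n : nat) (hm : (1 <= m)%N) (hn : (1 <= n)%N)
    (z : R[i]) :
  hyp2F1 ((1 - n%:R) / 2) ((2 - n%:R) / 2) (3 / 2 - m%:R) (z ^+ 2) =
  1 / 2 ^+ m.+1 * ((m.-1)`!%:R / (odd_dfact m.-1)%:R) *
  \sum_(1 <= k < m.+1)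
     2 ^+ k * 'C(n.-1, k.-1)%:R * 'C(2 * m - k - 1, m.-1)%:R *
     ((1 - z) ^+ (n - k) - (-1) ^+ k * (1 + z) ^+ (n - k)) * z ^+ k.-1.
Proof.
case: m hm => // M _; case: n hn => // N _.
have -> : (1 - N.+1%:R) / 2 = - N%:R / 2 :> R[i] by rewrite -natr1; field.
have -> : (2 - N.+1%:R) / 2 = (1 - N%:R) / 2 :> R[i] by rewrite -natr1; field.
have -> : 3 / 2 - M.+1%:R = 1 / 2 - M%:R :> R[i] by rewrite -natr1; field.
rewrite (@hyp2F1_finite _ _ _ _ _ N.+1); last first.
  move=> j Nj; rewrite pochhammer_dup_bin bin_small ?mul0r //.
  by rewrite (leq_trans Nj) // leq_pmull.
rewrite big_add1 /= big_mkord.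
(* With k = i + 1 the sign -(-1)^k becomes +(-1)^i, and one factor 2 leaves the sum. *)
under [in RHS]eq_bigr => k _ do
  rewrite subSS exprS -subnDA addn1 mulnS add2n !subSS
          [(-1) ^+ _]exprS mulN1r mulNr opprK -!mulrA.
rewrite -mulr_sumr.
under [in RHS]eq_bigr => k _ do rewrite !mulrA.
rewrite sum_bin_moment !mulr_sumr; apply: eq_bigr => j _.
rewrite pochhammer_dup_bin bin_moment_even exprM.
have h := congr1 (fun k => k%:R : R[i]) (central_bin_odd_dfact M).
rewrite /= !natrM natrX in h.
have f0 k : k`!%:R != 0 :> R[i] by rewrite pnatr_eq0 -lt0n fact_gt0.
have p0 := pochhammer_half_neq0 R[i] M j.
have d0 : (odd_dfact M)%:R != 0 :> R[i].
  rewrite pnatr_eq0 -lt0n /odd_dfact big_nat prodn_cond_gt0 // => i /andP[i0 _].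
  by case: i i0 => // i _; rewrite mulnS add2n subn1.
have t0 : 2 ^+ M != 0 :> R[i] by rewrite expf_neq0 // pnatr_eq0.
(* Substitutes C(2M,M) = 2^M (2M-1)!! / M!. *)
rewrite (canRL (mulfK (f0 M)) h) !exprS; field.
by rewrite p0 d0 t0 !f0.
Qed.
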